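(* Let $(X,\rho)$ be a metric space with a Borel probability measure $\mu$ of full support, i.e. $\operatorname{supp}(\mu)=X$. Let $f:X\to\mathbb{R}$ be a Borel function which is continuous at some point $x\in X$. Then $$\lim_{\mu(V)\to0}\frac{1}{\mu(V)}\int_V|f(x)-f(y)|\,d\mu(y)=0$$ in the following sense: for every $\varepsilon>0$ there is an open neighbourhood $V$ of $x$ such that for every Borel subset $B\subseteq V$ of strictly positive measure, $$\frac{1}{\mu(B)}\int_B|f(x)-f(y)|\,d\mu(y)<\varepsilon .$$
   Context: The support of a Borel measure $\mu$ on $X$ is $\operatorname{supp}(\mu)=\{x\in X:\ \mu(U)>0\text{ for every open } U\ni x\}$. The displayed limit is defined to mean exactly the $\varepsilon$-neighbourhood statement in the claim. *)

(* Defs.v *)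
From HB Require Import structures.
From mathcomp Require Import all_boot all_order all_algebra.
From mathcomp Require Import all_classical all_reals all_analysis.

Set Implicit Arguments.
Unset Strict Implicit.
Unset Printing Implicit Defensive.
Import Order.TTheory GRing.Theory Num.Theory.
Import numFieldNormedType.Exports.

Local Open Scope classical_set_scope.
Local Open Scope ring_scope.
Local Open Scope ereal_scope.

(* The library only puts a measurableType structure on pointed types, so metric
   spaces are taken with an arbitrary distinguished point. This excludes only
   the empty space, which carries no probability measure. *)
#[short(type="pmetricType")]
HB.structure Definition PointedMetric (K : numDomainType) :=
  { M of Metric K M & isPointed M }.

(* X equipped with its Borel sigma-algebra, generated by the open sets. *)
Notation borelType X := (g_sigma_algebraType (@open X)).

Definition msupport (R : realType) (X : pmetricType R)
    (mu : {measure set (borelType X) -> \bar R}) : set X :=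
  [set x : X | forall U : set X, open U -> U x -> 0 < mu U].

(* Main.v *)
Require Import Defs.
From mathcomp Require Import all_boot all_order all_algebra.
From mathcomp Require Import all_classical all_reals all_analysis.
From mathcomp Require Import measurable_realfun.

Import Order.TTheory GRing.Theory Num.Theory.
Import numFieldNormedType.Exports.

Local Open Scope classical_set_scope.
Local Open Scope ring_scope.
Local Open Scope ereal_scope.

(** By continuity at [x] there is an open neighbourhood [V] of [x] on which
    [`|f x - f y|] is less than [eps / 2].  An average of a function over a set
    of positive finite measure never exceeds a pointwise bound of that function
    on the set ([le_average]), so the average over any Borel [B] inside [V] is
    at most [eps / 2], hence less than [eps].  Halving [eps] replaces a
    discussion of when integration preserves strict inequalities. *)

(** Monotonicity of the integral gives [c * mu B] as a bound on the integral;
    positivity and finiteness of [mu B] make the extended-real inverse a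
    genuine division. *)
Lemma le_average (d : measure_display) (T : measurableType d) (R : realType)
    (mu : {measure set T -> \bar R}) (B : set T) (g : T -> R) (c : R) :
  measurable B -> 0 < mu B -> mu B < +oo -> measurable_fun B g ->
  (forall y, B y -> (0 <= g y <= c)%R) ->
  (mu B)^-1 * \int[mu]_(y in B) (g y)%:E <= c%:E.
Proof.
move=> mB B0 Boo mg gc.
have int_le : \int[mu]_(y in B) (g y)%:E <= c%:E * mu B.
  rewrite -integral_cst//; apply: ge0_le_integral => //.
  - by move=> y /gc/andP[g0 _]; rewrite lee_fin.
  - exact/measurable_EFinP.
  - by move=> y /gc/andP[_ gyc]; rewrite lee_fin.
have Bfin : mu B \is a fin_num by rewrite ge0_fin_numE// ltW.
move: B0 int_le; rewrite -(fineK Bfin) lte_fin => B0 int_le.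
by rewrite inver gt_eqF// lee_pdivrMl// muleC.
Qed.

Theorem theorem6p2p1 (R : realType) (X : pmetricType R)
    (mu : probability (borelType X) R)
    (mu_full : msupport mu = [set: X])
    (f : X -> R) (mf : measurable_fun [set: borelType X] f)
    (x : X) (cf : {for x, continuous f}) :
  forall eps : R, (0 < eps)%R ->
  exists V : set X, open_nbhs x V /\
    forall B : set (borelType X), measurable B -> B `<=` V -> 0 < mu B ->
      (mu B)^-1 * \int[mu]_(y in B) (`|f x - f y|%R)%:E < eps%:E.
Proof.
move=> eps eps0.
have eps20 : (0 < eps / 2)%R by rewrite divr_gt0.
have f_near : nbhs x [set y | (`|f x - f y| < eps / 2)%R].
  by move/cvgrPdist_lt : cf; apply.
exists [set y | (`|f x - f y| < eps / 2)%R]^°; split.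
  by split; [exact: open_interior|exact: f_near].
move=> B mB BV B0; apply: (@le_lt_trans _ _ (eps / 2)%:E); last first.
  by rewrite lte_fin ltr_pdivrMr// ltr_pMr// ltr1n.
apply: le_average => //.
- by rewrite (le_lt_trans (probability_le1 _ _))// ltry.
- apply: measurable_funTS; apply: measurableT_comp => //.
  exact: measurable_funB.
- by move=> y /BV/interior_subset/ltW ->; rewrite normr_ge0.
Qed.
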